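(* Let $ok\in AP$. The following problem is undecidable: given an ACGS $M=(G,\pi)$ whose set of agents $Ag$ satisfies $\{1,2,3\}\subseteq Ag$, with $\pi(1)=\pi(2)=\mathtt{iR}$ and $\pi(i)=\mathtt{IR}$ for all $i\in Ag\setminus\{1,2\}$, decide whether $M,s\models\langle\langle\{1,2\}\rangle\rangle\mathbf G\, ok$ for every initial state $s$ of $M$ (here $\langle\langle\{1,2\}\rangle\rangle\mathbf G\,ok$ is regarded as an ATL or ATL$^\ast$ formula).
   Context: Fix a finite set $AP$ of atomic propositions. A concurrent game structure (CGS) is a tuple $G=(S,S_0,Ag,(Ac_i)_{i\in Ag},(\sim_i)_{i\in Ag},(P_i)_{i\in Ag},\Delta,\lambda)$ where $S$ is a finite set of states, $S_0\subseteq S$ initial states, $Ag=\{1,\dots,n\}$ agents, $Ac_i$ finite local actions of agent $i$, $\sim_i\subseteq S\times S$ an equivalence relation, $P_i:S\to 2^{Ac_i}$ a protocol with $P_i(s)=P_i(s')$ whenever $s\sim_i s'$, $\Delta:S\times\prod_{i\in Ag}Ac_i\to S$, and $\lambda:S\to 2^{AP}$. A path is an infinite sequence $s_0s_1\dots$ with $s_{j+1}=\Delta(s_j,\vec a_j)$ for some $\vec a_j\in\prod_iP_i(s_j)$; a history is a finite nonempty prefix of a path ($\mathrm{FPath}$ the set of histories, $\mathrm{last}(\rho)$ its last state). Histories $s_0\dots s_m$, $s'_0\dots s'_m$ are indistinguishable for $i$ if $s_j\sim_i s'_j$ for all $j$. Strategy types: an $\mathtt{Ir}$-strategy of $i$ is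 $\theta:S\to Ac_i$ with $\theta(s)\in P_i(s)$; an $\mathtt{IR}$-strategy is $\theta:\mathrm{FPath}\to Ac_i$ with $\theta(\rho)\in P_i(\mathrm{last}(\rho))$; $\mathtt{ir}$-strategies are $\mathtt{Ir}$-strategies with $s\sim_is'\Rightarrow\theta(s)=\theta(s')$; $\mathtt{iR}$-strategies are $\mathtt{IR}$-strategies giving equal actions on histories indistinguishable for $i$. Memoryless strategies act on histories via the last state. Given a state $s$ and a strategy for every agent, the play from $s$ is the unique path $\rho$ with $\rho_0=s$, $\rho_{j+1}=\Delta(\rho_j,\vec a_j)$, $\vec a_j(i)$ being the action of $i$'s strategy on $\rho_0\dots\rho_j$. An ACGS is a pair $M=(G,\pi)$ with $\pi:Ag\to\{\mathtt{Ir},\mathtt{IR},\mathtt{ir},\mathtt{iR}\}$ such that $\sim_i$ is the identity whenever $\pi(i)\in\{\mathtt{IR},\mathtt{Ir}\}$. For $A\subseteq Ag$, $M,s\models\langle\langle A\rangle\rangle\phi$ iff there is an assignment of a $\pi(i)$-strategy to each $i\in A$ such that for every assignment of a $\pi(i)$-strategy to each $i\in Ag\setminus A$, the resulting play from $s$ satisfies the path formula $\phi$. In particular $M,s\models\langle\langle A\rangle\rangle\mathbf G\,ok$ means the play visits only states $t$ with $ok\in\lambda(t)$. *)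

(* Defs.v *)
From HB Require Import structures.
From mathcomp Require Import all_boot.

Set Implicit Arguments.
Unset Strict Implicit.
Unset Printing Implicit Defensive.

(* 1. A model of computation: Minsky counter machines with unboundedly *)
(*    many registers (Turing complete).                                *)

Inductive cm_instr :=
  | INC of nat
  | DEC of nat & nat.

Definition cm_prog := seq cm_instr.

Definition cm_config := (nat * (nat -> nat))%type.

Definition cm_upd (reg : nat -> nat) (r v : nat) : nat -> nat :=
  fun x => if x == r then v else reg x.

Definition cm_step (P : cm_prog) (c : cm_config) : cm_config :=
  let: (pc, reg) := c in
  if pc < size P then
    match nth (INC 0) P pc with
    | INC r => (pc.+1, cm_upd reg r (reg r).+1)
    | DEC r j => if reg r == 0 then (j, reg) else (pc.+1, cm_upd reg r (reg r).-1)
    end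
  else c.

Definition cm_halted (P : cm_prog) (c : cm_config) : bool := size P <= c.1.

Definition cm_init (n : nat) : cm_config := (0, fun r => if r == 0 then n else 0).

Definition cm_computes (P : cm_prog) (n m : nat) : Prop :=
  exists k, let c := iter k (cm_step P) (cm_init n) in cm_halted P c /\ c.2 0 = m.

(* A (promise) problem: instances x of a countable type X (encoded by
   [pickle]), a domain of admissible instances [Dom], and the yes-set [Q].
   It is decidable if some counter machine answers correctly (1 = yes,
   0 = no) on every admissible instance. *)
Definition decidable_on (X : countType) (Dom Q : X -> Prop) : Prop :=
  exists P : cm_prog, forall x, Dom x ->
    (Q x -> cm_computes P (pickle x) 1) /\ (~ Q x -> cm_computes P (pickle x) 0).

(*   States: 0 .. nS-1.  Agents: 0 .. nA-1 (internal index i stands   *)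
(*   for the paper's agent i+1).  Actions of agent i: 0 .. nac_i - 1.  *)
(*   ~_i : s ~_i s' iff cls_i(s) = cls_i(s')  (any equivalence on a    *)
(*   finite set is of this form).  P_i(s) = list prot_i(s).            *)

Definition st_Ir := 0. Definition st_IR := 1. Definition st_ir := 2. Definition st_iR := 3.

Record acgs (AP : countType) := ACGS {
  nS    : nat;
  init  : seq nat;
  nA    : nat;
  nac   : seq nat;
  cls   : seq (seq nat);
  prot  : seq (seq (seq nat));
  dtab  : seq ((nat * seq nat) * nat);
  lab   : seq (seq AP);
  pity  : seq nat
}.

Definition acgs_tuple (AP : countType) (M : acgs AP) :=
  (nS M, init M, nA M, nac M, cls M, prot M, dtab M, lab M, pity M).
Definition tuple_acgs (AP : countType)
  (t : nat * seq nat * nat * seq nat * seq (seq nat) * seq (seq (seq nat))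
       * seq ((nat * seq nat) * nat) * seq (seq AP) * seq nat) : acgs AP :=
  let: (a, b, c, d, e, f, g, h, i) := t in ACGS a b c d e f g h i.
Lemma acgs_tupleK (AP : countType) : cancel (@acgs_tuple AP) (@tuple_acgs AP).
Proof. by case. Qed.
HB.instance Definition _ (AP : countType) :=
  Countable.copy (acgs AP) (can_type (@acgs_tupleK AP)).

Section Semantics.
Variables (AP : countType) (M : acgs AP).

Definition sim (i s s' : nat) : bool :=
  nth 0 (nth [::] (cls M) i) s == nth 0 (nth [::] (cls M) i) s'.
Definition P_ (i s : nat) : seq nat := nth [::] (nth [::] (prot M) i) s.
Definition Ac (i : nat) : nat := nth 0 (nac M) i.
Definition Delta (s : nat) (a : seq nat) : nat :=
  if [seq e <- dtab M | e.1 == (s, a)] is e :: _ then e.2 else 0.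
Definition lambda (s : nat) : seq AP := nth [::] (lab M) s.
Definition pi_ (i : nat) : nat := nth 0 (pity M) i.

Definition joint_ok (s : nat) (a : seq nat) : Prop :=
  size a = nA M /\ forall i, i < nA M -> nth 0 a i \in P_ i s.

Definition wf_acgs : Prop :=
  all (fun s => s < nS M) (init M) /\
  size (nac M) = nA M /\
  (size (cls M) = nA M /\ all (fun c => size c == nS M) (cls M)) /\
  (size (prot M) = nA M /\ all (fun p => size p == nS M) (prot M)) /\
  (forall i s a, i < nA M -> s < nS M -> a \in P_ i s -> a < Ac i) /\
  (forall i s s', i < nA M -> s < nS M -> s' < nS M -> sim i s s' ->
      P_ i s =i P_ i s') /\
  (forall s a, s < nS M -> size a = nA M ->
      (forall i, i < nA M -> nth 0 a i < Ac i) ->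
      exists t, ((s, a), t) \in dtab M) /\
  all (fun e => e.2 < nS M) (dtab M) /\
  size (lab M) = nS M /\
  size (pity M) = nA M /\
  (forall i, i < nA M -> pi_ i <= 3) /\
  (forall i s s', i < nA M -> (pi_ i == st_IR) || (pi_ i == st_Ir) ->
      s < nS M -> s' < nS M -> sim i s s' -> s = s').

Definition is_hist (h : seq nat) : Prop :=
  [/\ h != [::], all (fun s => s < nS M) h &
      forall j, j.+1 < size h -> exists a, joint_ok (nth 0 h j) a /\
                                  Delta (nth 0 h j) a = nth 0 h j.+1].

Definition indist (i : nat) (h h' : seq nat) : Prop :=
  size h = size h' /\ forall j, j < size h -> sim i (nth 0 h j) (nth 0 h' j).

(* every strategy is represented by its action on histories;
   memoryless strategies act via the last state *)
Definition is_strategy (i : nat) (th : seq nat -> nat) : Prop :=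
  if (pi_ i == st_IR) then
    forall h, is_hist h -> th h \in P_ i (last 0 h)
  else if (pi_ i == st_iR) then
    (forall h, is_hist h -> th h \in P_ i (last 0 h)) /\
    (forall h h', is_hist h -> is_hist h' -> indist i h h' -> th h = th h')
  else if (pi_ i == st_Ir) then
    exists f : nat -> nat, (forall s, s < nS M -> f s \in P_ i s) /\
                           (forall h, th h = f (last 0 h))
  else
    exists f : nat -> nat, (forall s, s < nS M -> f s \in P_ i s) /\
      (forall s s', s < nS M -> s' < nS M -> sim i s s' -> f s = f s') /\
      (forall h, th h = f (last 0 h)).

Fixpoint play_prefix (th : nat -> seq nat -> nat) (s : nat) (k : nat) : seq nat :=
  match k with
  | 0 => [:: s]
  | k'.+1 => let h := play_prefix th s k' in
             rcons h (Delta (last s h) [seq th i h | i <- iota 0 (nA M)])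
  end.

Definition play (th : nat -> seq nat -> nat) (s j : nat) : nat :=
  last s (play_prefix th s j).

Definition sat_coal_G (A : seq nat) (ok : AP) (s : nat) : Prop :=
  exists thA : nat -> seq nat -> nat,
    (forall i, i < nA M -> i \in A -> is_strategy i (thA i)) /\
    forall thO : nat -> seq nat -> nat,
      (forall i, i < nA M -> i \notin A -> is_strategy i (thO i)) ->
      forall j, ok \in lambda (play (fun i => if i \in A then thA i else thO i) s j).

End Semantics.

Definition admissible (AP : countType) (M : acgs AP) : Prop :=
  [/\ wf_acgs M, 3 <= nA M, pi_ M 0 = st_iR, pi_ M 1 = st_iR &
      forall i, 2 <= i < nA M -> pi_ M i = st_IR].

Definition yes_instance (AP : countType) (ok : AP) (M : acgs AP) : Prop :=
  forall s, s \in init M -> sat_coal_G M [:: 0; 1] ok s.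

(* Main.v *)
Require Import Defs.
From mathcomp Require Import all_boot.
From mathcomp Require Import zify.
From Stdlib Require Import FunctionalExtensionality.

(* The adversary silently lets time pass, and at a time of its choice tells a
   player to start emitting an infinite stream of letters; only the starting
   time x is known to that player. If the adversary starts both players together, it
   checks that their streams agree and avoid a bad letter; if it starts player
   2 one step after player 1, it checks that the stream for x + 1 is the image
   of the stream for x under a fixed Mealy machine; at the earliest time it
   checks that the stream is alpha ^ c beta ^ omega. So the coalition wins iff
   no iterate of the Mealy machine on this stream contains a bad letter. A
   stream can encode a counter machine configuration (the program counter,
   then the registers in unary on parallel tracks), one step being a Mealy
   machine: the coalition wins iff a machine D never halts on an input v, with
   c = v + 1.

   In this game v only determines the length of a chain of states, so that the
   code of the game is a simple function of v, of the numbers of letters and of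
   Mealy states, and of the code of the part of the transition table outside of
   the chain. These numbers depend on D but not on v, hence v can be chosen to
   encode them. Given a decider P, let D compute from v the code of its own
   game, run P on it, and halt iff the answer is yes: P is wrong on this
   game. *)

Set Implicit Arguments.
Unset Strict Implicit.
Unset Printing Implicit Defensive.

(** * Computing with counter machines *)

Notation regs := (nat -> nat).

Lemma updE (rho : regs) r v : cm_upd rho r v r = v.
Proof. by rewrite /cm_upd eqxx. Qed.

Lemma updN (rho : regs) r v x : x != r -> cm_upd rho r v x = rho x.
Proof. by rewrite /cm_upd => /negPf->. Qed.

Lemma upd_id (rho : regs) r v : rho r = v -> cm_upd rho r v = rho.
Proof.
move=> <-; apply: functional_extensionality => x.
by rewrite /cm_upd; case: eqP => [->|].
Qed.

Ltac reg_ext :=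
  let x := fresh "x" in
  apply: functional_extensionality => x; rewrite /cm_upd;
  repeat (case: eqP => ? /=; subst => //); try lia; try congruence.

Ltac cases_upd := rewrite /cm_upd; repeat (case: eqP => ? //=); try lia.

(** * Program fragments and their composition *)

Definition reach (P : cm_prog) (c c' : cm_config) : Prop :=
  exists k, iter k (cm_step P) c = c'.

Lemma reach_refl P c : reach P c c.
Proof. by exists 0. Qed.

Lemma reach_step P c c' : reach P (cm_step P c) c' -> reach P c c'.
Proof. by case=> k <-; exists k.+1; rewrite iterSr. Qed.

Lemma reach_trans P c c' c'' : reach P c c' -> reach P c' c'' -> reach P c c''.
Proof. by case=> k <- [l <-]; exists (l + k); rewrite iterD. Qed.

Lemma cm_step_instr l i r rho : cm_step (l ++ i :: r) (size l, rho) =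
  match i with
  | INC q => ((size l).+1, cm_upd rho q (rho q).+1)
  | DEC q j => if rho q == 0 then (j, rho)
               else ((size l).+1, cm_upd rho q (rho q).-1)
  end.
Proof. by rewrite /cm_step size_cat /= -addSnnS leq_addr nth_cat ltnn subnn. Qed.

(* A fragment receives its own absolute address, as jumps are absolute. *)
Definition frag := nat -> cm_prog.

(** The surrounding code [l], [r] is arbitrary, so that fragments compose by concatenation; control
    leaves a fragment at the address just behind it. *)
Definition runs (f : frag) (rho rho' : regs) : Prop := forall l r,
  reach (l ++ f (size l) ++ r) (size l, rho) (size l + size (f (size l)), rho').

Definition frag_skip : frag := fun _ => [::].
Definition frag_inc r : frag := fun _ => [:: INC r].
Definition frag_seq (f g : frag) : frag := fun o => f o ++ g (o + size (f o)).
(* Register 0 is kept at 0, so that [DEC 0 o] is an unconditional jump. *)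
Definition frag_loop r (f : frag) : frag := fun o =>
  DEC r (o + (size (f o.+1)).+2) :: f o.+1 ++ [:: DEC 0 o].

Lemma runs_skip rho : runs frag_skip rho rho.
Proof. by move=> l r; rewrite addn0; apply: reach_refl. Qed.

Lemma runs_inc q rho : runs (frag_inc q) rho (cm_upd rho q (rho q).+1).
Proof.
by move=> l r; exists 1; rewrite [iter _ _ _]cm_step_instr /= addn1.
Qed.

Lemma runs_seq f g rho rho' rho'' :
  runs f rho rho' -> runs g rho' rho'' -> runs (frag_seq f g) rho rho''.
Proof.
move=> Hf Hg l r; rewrite /frag_seq -catA; apply: reach_trans (Hf _ _) _.
have := Hg (l ++ f (size l)) r.
by rewrite !size_cat -!catA addnA.
Qed.

(** [st i] is an explicit loop invariant: the registers after [i] rounds. The body starts after the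
    decrement of [q], and [st i 0 = 0] makes the closing [DEC 0 o] jump back. *)
Lemma runs_loop q f (st : nat -> regs) n :
  (forall i, i <= n -> st i q = n - i /\ st i 0 = 0) ->
  (forall i, i < n -> runs f (cm_upd (st i) q (n - i).-1) (st i.+1)) ->
  runs (frag_loop q f) (st 0) (st n).
Proof.
move=> Hq Hf l r; set o := size l; set F := frag_loop q f o.
have Ffr : F = [:: DEC q (o + (size (f o.+1)).+2)] ++ f o.+1 ++ [:: DEC 0 o] by [].
have szF : size F = (size (f o.+1)).+2 by rewrite Ffr /= size_cat addn1.
have loop j i : i + j = n -> reach (l ++ F ++ r) (o, st i) (o + size F, st n).
  elim: j i => [|j IHj] i Eij; have [|Hqi H0i] := Hq i; try by lia.
    apply: reach_step; rewrite cm_step_instr Hqi.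
    have -> : i = n by lia.
    by rewrite subnn eqxx -szF; apply: reach_refl.
  apply: reach_step; rewrite cm_step_instr Hqi ifF; last by apply/eqP; lia.
  have lt_in : i < n by lia.
  have := Hf i lt_in (rcons l (DEC q (o + (size (f o.+1)).+2))) (DEC 0 o :: r).
  rewrite size_rcons -/o cat_rcons => Hb.
  have E : l ++ F ++ r = l ++ DEC q (o + (size (f o.+1)).+2)
      :: f o.+1 ++ DEC 0 o :: r.
    by rewrite Ffr -!catA.
  rewrite E; apply: reach_trans Hb _; rewrite -E.
  apply: reach_step.
  have -> : l ++ F ++ r =
      (l ++ DEC q (o + (size (f o.+1)).+2) :: f o.+1) ++ DEC 0 o :: r.
    by rewrite E -!catA.
  have -> : o.+1 + size (f o.+1) =
      size (l ++ DEC q (o + (size (f o.+1)).+2) :: f o.+1).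
    by rewrite size_cat /= addnS addSn.
  rewrite cm_step_instr (Hq i.+1 lt_in).2 -catA /= -/o.
  have := IHj i.+1; rewrite E; apply; lia.
exact: loop.
Qed.

Lemma runs_clear q rho : q != 0 -> rho 0 = 0 ->
  runs (frag_loop q frag_skip) rho (cm_upd rho q 0).
Proof.
move=> q0 r0; set n := rho q.
have := @runs_loop q frag_skip (fun i => cm_upd rho q (n - i)) n.
rewrite subnn subn0 (upd_id (erefl : rho q = n)); apply.
  by move=> i _; rewrite updE updN // eq_sym.
move=> i _; rewrite (_ : cm_upd _ q _ = cm_upd rho q (n - i.+1)).
  exact: runs_skip.
by reg_ext.
Qed.

Lemma runs_move q p rho : q != 0 -> p != 0 -> p != q -> rho 0 = 0 ->
  rho p = 0 ->
  runs (frag_loop q (frag_inc p)) rho (cm_upd (cm_upd rho q 0) p (rho q)).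
Proof.
move=> q0 p0 pq r0 rp; set n := rho q.
have := @runs_loop q (frag_inc p)
  (fun i => cm_upd (cm_upd rho q (n - i)) p i) n.
rewrite subnn subn0 (upd_id (erefl : rho q = n)) (upd_id rp); apply.
  by move=> i _; rewrite updN 1?eq_sym // updE !updN // eq_sym.
move=> i _; set rho1 := (X in runs _ X _).
rewrite (_ : cm_upd _ _ _ = cm_upd rho1 p (rho1 p).+1).
  exact: runs_inc.
by rewrite /rho1 updN // updE; reg_ext.
Qed.

Lemma runs_move2 q p t rho : q != 0 -> p != 0 -> t != 0 -> p != q -> t != q ->
  p != t -> rho 0 = 0 -> rho p = 0 -> rho t = 0 ->
  runs (frag_loop q (frag_seq (frag_inc p) (frag_inc t))) rho
    (cm_upd (cm_upd (cm_upd rho q 0) p (rho q)) t (rho q)).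
Proof.
move=> q0 p0 t0 pq tq pt r0 rp rt; set n := rho q.
have := @runs_loop q (frag_seq (frag_inc p) (frag_inc t))
  (fun i => cm_upd (cm_upd (cm_upd rho q (n - i)) p i) t i) n.
rewrite subnn subn0 (upd_id (erefl : rho q = n)) (upd_id rp) (upd_id rt); apply.
  move=> i _; rewrite updN 1?eq_sym // updN 1?eq_sym // updE !updN //;
  by rewrite eq_sym.
move=> i _; set rho1 := (X in runs _ X _).
apply: runs_seq; first exact: runs_inc.
set rho2 := (X in runs _ X _).
rewrite (_ : cm_upd _ t _ = cm_upd rho2 t (rho2 t).+1).
  exact: runs_inc.
have -> : rho2 t = i.
  by rewrite /rho2 /rho1 updN 1?eq_sym // updN // updE.
rewrite /rho2 (_ : rho1 p = i); last by rewrite /rho1 updN // updN // updE.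
rewrite /rho1; reg_ext.
Qed.

(* [computable d f]: for every k >= d, some fragment computes f of the
   registers below d into register k, using the registers above k as scratch
   stack. *)
Definition computable (d : nat) (f : regs -> nat) : Prop :=
  (forall rho rho' : regs, (forall i, i < d -> rho i = rho' i) -> f rho = f rho')
  /\ forall k, 0 < k -> d <= k -> exists fr, forall rho : regs,
     rho 0 = 0 -> (forall i, k <= i -> rho i = 0) ->
     runs fr rho (cm_upd rho k (f rho)).

Lemma comp_ext d f g : f =1 g -> computable d f -> computable d g.
Proof.
move=> E [loc ex]; split=> [rho rho' H|k k0 dk]; first by rewrite -!E; apply: loc.
by have [fr H] := ex k k0 dk; exists fr => rho r0 rk; rewrite -E; apply: H.
Qed.

Lemma comp_weak d d' f : d <= d' -> computable d f -> computable d' f.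
Proof.
move=> dd [loc ex]; split=> [rho rho' H|k k0 dk].
  by apply: loc => i lt_id; apply: H; apply: leq_trans dd.
by apply: ex => //; apply: leq_trans dk.
Qed.

(** Reading a register empties it: its value is moved to [k] and [k.+1] together, then restored from
    [k.+1]. *)
Lemma comp_var d i : 0 < i -> i < d -> computable d (fun rho => rho i).
Proof.
move=> i0 id; split=> [rho rho' H|k k0 dk]; first exact: H.
exists (frag_seq (frag_loop i (frag_seq (frag_inc k) (frag_inc k.+1)))
                 (frag_loop k.+1 (frag_inc i))) => rho r0 rk.
apply: runs_seq.
  by apply: runs_move2; rewrite ?r0 ?rk //; lia.
set rho1 := (X in runs _ X _).
rewrite (_ : cm_upd rho k _ = cm_upd (cm_upd rho1 k.+1 0) i (rho1 k.+1)).
  apply: runs_move => //; (try lia); rewrite /rho1; cases_upd.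
have rk1 := rk k.+1 (leqnSn k).
rewrite /rho1 updE; reg_ext.
Qed.

Lemma comp_zero d : computable d (fun=> 0).
Proof.
split=> // k _ _; exists frag_skip => rho _ rk.
by rewrite upd_id ?rk //; apply: runs_skip.
Qed.

Lemma comp_succ d f : computable d f -> computable d (fun rho => (f rho).+1).
Proof.
move=> [loc ex]; split=> [rho rho' /loc->//|k k0 dk].
have [fr H] := ex k k0 dk; exists (frag_seq fr (frag_inc k)) => rho r0 rk.
apply: runs_seq (H _ r0 rk) _; set rho1 := (X in runs _ X _).
rewrite (_ : cm_upd rho k _ = cm_upd rho1 k (rho1 k).+1); first exact: runs_inc.
by rewrite /rho1 updE; reg_ext.
Qed.

Lemma comp_const d n : computable d (fun=> n).
Proof. by elim: n => [|n IHn]; [apply: comp_zero | apply: comp_succ]. Qed.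

(** Primitive recursion. The step must preserve computability over every larger set of registers, so
    that it may itself be an iteration that uses the outer index and accumulator. *)
Lemma comp_iter d (n z : regs -> nat) (s : regs -> nat -> nat -> nat) :
  computable d n -> computable d z ->
  (forall d' u v, d <= d' -> computable d' u -> computable d' v ->
     computable d' (fun rho => s rho (u rho) (v rho))) ->
  computable d (fun rho => iteri (n rho) (s rho) (z rho)).
Proof.
move=> [nloc nex] [zloc zex] cs.
have sloc (rho rho' : regs) a b : (forall i, i < d -> rho i = rho' i) ->
    s rho a b = s rho' a b.
  move=> E; have [loc _] := cs d _ _ (leqnn d) (comp_const d a) (comp_const d b).
  exact: loc.
split=> [rho rho' E|k k0 dk].
  rewrite (nloc _ _ E) (zloc _ _ E); elim: (n rho') => //= m ->.
  exact: sloc.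
have [fn Hn] := nex k k0 dk.
have [fz Hz] := zex k.+2 isT (leq_trans dk (leqW (leqnSn k))).
have [|||_ /(_ k.+3 isT (leqnn _)) [fs Hs]] :=
    cs k.+3 (fun rho => rho k.+1) (fun rho => rho k.+2).
- lia.
- by apply: comp_var; lia.
- by apply: comp_var; lia.
(* Register [k] counts the remaining rounds, [k.+1] holds the index, [k.+2] the accumulator and
   [k.+3] its new value. *)
pose body := frag_seq fs (frag_seq (frag_loop k.+2 frag_skip)
   (frag_seq (frag_loop k.+3 (frag_inc k.+2)) (frag_inc k.+1))).
exists (frag_seq fn (frag_seq fz (frag_seq (frag_loop k body)
   (frag_seq (frag_loop k.+1 frag_skip) (frag_loop k.+2 (frag_inc k)))))).
move=> rho r0 rk.
pose N := n rho; pose acc i := iteri i (s rho) (z rho).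
pose mk a b c : regs := cm_upd (cm_upd (cm_upd rho k a) k.+1 b) k.+2 c.
have mk0 a b c : mk a b c 0 = 0 by rewrite /mk; cases_upd.
have mkk a b c : mk a b c k = a by rewrite /mk; cases_upd.
have mk1 a b c : mk a b c k.+1 = b by rewrite /mk; cases_upd.
have mk2 a b c : mk a b c k.+2 = c by rewrite /mk; cases_upd.
have mklt a b c i : i < k -> mk a b c i = rho i.
  by rewrite /mk /cm_upd => ?; repeat case: eqP => ? //; lia.
have mkgt a b c i : k.+2 < i -> mk a b c i = 0.
  move=> ?; rewrite /mk /cm_upd; repeat case: eqP => ? //; try lia.
  by apply: rk; lia.
have updE0 i : rho (k + i) = 0 by apply: rk; rewrite leq_addr.
have mkN : cm_upd rho k N = mk N 0 0.
  apply: functional_extensionality => x; rewrite /mk /cm_upd.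
  by repeat case: eqP => ?; subst => //; try lia; apply: rk; lia.
apply: (@runs_seq _ _ _ (mk N 0 0)); first by rewrite -mkN; apply: Hn.
apply: (@runs_seq _ _ _ (mk N 0 (z rho))).
  have -> : mk N 0 (z rho) = cm_upd (mk N 0 0) k.+2 (z (mk N 0 0)).
    rewrite (zloc (mk N 0 0) rho) => [|i lt_i]; last by apply: mklt; lia.
    by rewrite /mk; reg_ext.
  apply: Hz => // i; rewrite leq_eqVlt => /predU1P[<-//|]; exact: mkgt.
apply: (@runs_seq _ _ _ (mk 0 N (acc N))).
  have := @runs_loop k body (fun i => mk (N - i) i (acc i)) N.
  rewrite subnn subn0; apply=> [//|i lt_iN].
  have -> : cm_upd (mk (N - i) i (acc i)) k (N - i).-1 = mk (N - i.+1) i (acc i).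
    by rewrite /mk; reg_ext.
  set a := N - i.+1; set b := acc i.
  pose rho1 := cm_upd (mk a i b) k.+3 (acc i.+1).
  apply: (@runs_seq _ _ _ rho1).
    have -> : rho1 = cm_upd (mk a i b) k.+3
       (s (mk a i b) (mk a i b k.+1) (mk a i b k.+2)).
      rewrite mk1 mk2 (sloc (mk a i b) rho) // => j lt_j; apply: mklt; lia.
    by apply: Hs => // j; apply: mkgt.
  apply: runs_seq.
    by apply: runs_clear => //; rewrite /rho1 updN.
  apply: runs_seq.
    by apply: runs_move; (try lia); rewrite /rho1; cases_upd.
  set rho2 := (X in runs _ X _).
  have -> : mk a i.+1 (acc i.+1) = cm_upd rho2 k.+1 (rho2 k.+1).+1.
    have -> : rho2 k.+1 = i by rewrite /rho2 /rho1 !updN //; lia.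
    have rk3 := rk k.+3 (leq_trans (leqnSn k) (leq_trans (leqnSn _) (leqnSn _))).
    by rewrite /rho2 /rho1 /mk; reg_ext.
  exact: runs_inc.
apply: (@runs_seq _ _ _ (mk 0 0 (acc N))).
  have -> : mk 0 0 (acc N) = cm_upd (mk 0 N (acc N)) k.+1 0.
    by rewrite /mk; reg_ext.
  exact: runs_clear.
have -> : cm_upd rho k (acc N) =
    cm_upd (cm_upd (mk 0 0 (acc N)) k.+2 0) k (mk 0 0 (acc N) k.+2).
  rewrite mk2; apply: functional_extensionality => x; rewrite /mk /cm_upd.
  by repeat case: eqP => ?; subst => //; try lia; apply: rk; lia.
by apply: runs_move; rewrite ?mkk //; lia.
Qed.

(** * Computable arithmetic and codes of lists *)

Section Arithmetic.
Variables (d : nat) (f g h : regs -> nat).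
Hypotheses (cf : computable d f) (cg : computable d g) (ch : computable d h).

Lemma comp_add : computable d (fun rho => f rho + g rho).
Proof.
apply: (@comp_ext _ (fun rho => iteri (f rho) (fun _ m => m.+1) (g rho))).
  by move=> rho; elim: (f rho) => //= n ->.
by apply: comp_iter => // d' u v _ _ cv; apply: comp_succ.
Qed.

Lemma comp_pred : computable d (fun rho => (f rho).-1).
Proof.
apply: (@comp_ext _ (fun rho => iteri (f rho) (fun i _ => i) 0)).
  by move=> rho; case: (f rho).
by apply: comp_iter => //; apply: comp_zero.
Qed.

Lemma comp_if0 : computable d (fun rho => if f rho == 0 then g rho else h rho).
Proof.
apply: (@comp_ext _ (fun rho => iteri (f rho) (fun _ _ => h rho) (g rho))).
  by move=> rho; case: (f rho).
by apply: comp_iter => // d' u v dd _ _; apply: comp_weak ch.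
Qed.

End Arithmetic.

Lemma comp_sub d f g : computable d f -> computable d g ->
  computable d (fun rho => f rho - g rho).
Proof.
move=> cf cg.
apply: (@comp_ext _ (fun rho => iteri (g rho) (fun _ m => m.-1) (f rho))).
  by move=> rho; elim: (g rho) => [|n /= ->]; rewrite ?subn0 ?subnS.
by apply: comp_iter => // d' u v _ _ cv; apply: comp_pred.
Qed.

Lemma comp_mul d f g : computable d f -> computable d g ->
  computable d (fun rho => f rho * g rho).
Proof.
move=> cf cg.
apply: (@comp_ext _ (fun rho => iteri (f rho) (fun _ m => g rho + m) 0)).
  by move=> rho; elim: (f rho) => //= n ->; rewrite mulSn.
apply: comp_iter (comp_zero _) _ => // d' u v dd _ cv.
by apply: comp_add => //; apply: comp_weak cg.
Qed.

(** The code that [pickle] gives to a list with head code [a] and tail code [m]: one step of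
    [CodeSeq.code]. *)
Definition consc (a m : nat) : nat := 2 ^ a * m.*2.+1.

Lemma comp_consc d f g : computable d f -> computable d g ->
  computable d (fun rho => consc (f rho) (g rho)).
Proof.
move=> cf cg; apply: comp_mul.
  apply: (@comp_ext _ (fun rho => iteri (f rho) (fun _ m => m + m) 1)).
    by move=> rho; elim: (f rho) => //= n ->; rewrite expnS mul2n addnn.
  by apply: comp_iter (comp_const _ 1) _ => // d' u v _ _ cv; apply: comp_add.
by apply/comp_succ/(comp_ext _ (comp_add cg cg)) => rho; rewrite addnn.
Qed.

Lemma comp_if_eq d f g h k : computable d f -> computable d g ->
  computable d h -> computable d k ->
  computable d (fun rho => if f rho == g rho then h rho else k rho).
Proof.
move=> cf cg ch ck.
apply: (@comp_ext _ (fun rho =>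
  if (f rho - g rho) + (g rho - f rho) == 0 then h rho else k rho)).
  by move=> rho; congr (if _ then _ else _); lia.
by apply: comp_if0 => //; apply: comp_add; apply: comp_sub.
Qed.

Lemma consc_inj a b a' b' : (consc a b == consc a' b') = (a == a') && (b == b').
Proof.
have -> : consc a b = CodeSeq.code (a :: CodeSeq.decode b).
  by rewrite /consc -{1}(CodeSeq.decodeK b).
have -> : consc a' b' = CodeSeq.code (a' :: CodeSeq.decode b').
  by rewrite /consc -{1}(CodeSeq.decodeK b').
rewrite (inj_eq (can_inj CodeSeq.codeK)) eqseq_cons.
by rewrite (inj_eq (can_inj CodeSeq.decodeK)).
Qed.

(** Decoding by exhaustive search: [v = consc a b] forces [a] and [b] below [v], and two nested
    bounded loops are computable by [comp_iter]. *)
Definition search (g : nat -> nat -> nat) (v : nat) : nat :=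
  iteri v (fun a m => iteri v (fun b m => if consc a b == v then g a b else m) m) 0.

Lemma iteri_select n i (F : nat -> nat) z : i < n ->
  iteri n (fun j m => if j == i then F j else m) z = F i.
Proof.
elim: n => // n IHn; rewrite ltnS leq_eqVlt => /predU1P[->|lt_i] /=.
  by rewrite eqxx.
by rewrite IHn // ifF //; lia.
Qed.

Lemma eq_iteri n (F G : nat -> nat -> nat) z :
  (forall i m, i < n -> F i m = G i m) -> iteri n F z = iteri n G z.
Proof. by elim: n => //= n IHn E; rewrite IHn ?E // => i m lt_i; apply: E; lia. Qed.

Lemma iteri_id n z : iteri n (fun _ (m : nat) => m) z = z.
Proof. by elim: n. Qed.

Lemma searchE g a b : search g (consc a b) = g a b.
Proof.
rewrite /search; set v := consc a b.
have p2 : 2 ^ a > a by apply: ltn_expl.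
have [lt_a lt_b] : a < v /\ b < v by rewrite /v /consc; split; nia.
rewrite (@eq_iteri _ _ (fun i m => if i == a then g i b else m)) => [|i m _].
  exact: (iteri_select (fun i => g i b)).
case: (i =P a) => [->|/eqP/negbTE ne_i].
  rewrite -[RHS](iteri_select (fun j => g a j) m lt_b); apply: eq_iteri => j k _.
  by rewrite /v consc_inj eqxx.
rewrite -[RHS](iteri_id v); apply: eq_iteri => j k _.
by rewrite /v consc_inj ne_i.
Qed.

Definition fstc := search (fun a _ => a).
Definition sndc := search (fun _ b => b).

Lemma fstcE a b : fstc (consc a b) = a. Proof. exact: searchE. Qed.
Lemma sndcE a b : sndc (consc a b) = b. Proof. exact: searchE. Qed.

Ltac comp_weaken :=
  match goal with H : computable ?d0 ?f |- computable ?d ?g =>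
    solve [apply: (@comp_weak d0 d); [lia | exact: H]] end.

Lemma comp_fstc d f : computable d f -> computable d (fun rho => fstc (f rho)).
Proof.
move=> cf; apply: comp_iter (comp_zero _) _ => // d1 u v ? ? ?.
apply: comp_iter => [|//|d2 u' v' ? ? ?]; first comp_weaken.
by apply: comp_if_eq => //; [apply: comp_consc | |]; comp_weaken.
Qed.

Lemma comp_sndc d f : computable d f -> computable d (fun rho => sndc (f rho)).
Proof.
move=> cf; apply: comp_iter (comp_zero _) _ => // d1 u v ? ? ?.
apply: comp_iter => [|//|d2 u' v' ? ? ?]; first comp_weaken.
by apply: comp_if_eq => //; [apply: comp_consc | ]; comp_weaken.
Qed.

(** Pairs are pickled as two-element lists. *)
Definition pairc (a b : nat) : nat := consc a (consc b 0).

Lemma comp_pairc d f g : computable d f -> computable d g ->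
  computable d (fun rho => pairc (f rho) (g rho)).
Proof. by move=> cf cg; do 2!apply: comp_consc => //; apply: comp_zero. Qed.

Definition nseqc (n x m : nat) : nat := iteri n (fun _ m => consc x m) m.
Definition iotac (n : nat) : nat := iteri n consc 0.

Lemma comp_nseqc d f g h : computable d f -> computable d g -> computable d h ->
  computable d (fun rho => nseqc (f rho) (g rho) (h rho)).
Proof.
by move=> cf cg ch; apply: comp_iter => // d' u v ? ? ?; apply: comp_consc => //;
  comp_weaken.
Qed.

Lemma comp_iotac d f : computable d f -> computable d (fun rho => iotac (f rho)).
Proof.
by move=> cf; apply: comp_iter (comp_zero _) _ => // *; apply: comp_consc.
Qed.

(** * The game of an iterated Mealy machine *)

Lemma mem_iteri (X : eqType) (A : nat -> Prop) (F : nat -> seq X -> seq X) x :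
  (forall i l, x \in F i l <-> A i \/ x \in l) ->
  forall n l, x \in iteri n F l <-> (exists2 i, i < n & A i) \/ x \in l.
Proof.
move=> HF; elim=> [|n IHn] l /=; first by split=> [|[[]|]]//; right.
rewrite HF IHn; split=> [[An|[[i lt_i Ai]|]]|[[i]|]]; last 1 first.
- by right; right.
- by left; exists n.
- by left; exists i => //; apply: ltnW.
- by right.
- rewrite ltnS leq_eqVlt => /predU1P[->|lt_i] Ai; [by left|right; left].
  by exists i.
Qed.

Lemma mem_iter_cons (X : eqType) (f : nat -> X) x n l :
  x \in iteri n (fun i s => f i :: s) l <-> (exists2 i, i < n & x = f i) \/ x \in l.
Proof.
apply: mem_iteri => i s; rewrite inE; split=> [/predU1P[]|[->|->]]; auto.
  by rewrite eqxx.
by rewrite orbT.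
Qed.

Lemma size_iter_cons (X : Type) (f : nat -> X) n l :
  size (iteri n (fun i s => f i :: s) l) = n + size l.
Proof. by elim: n => //= n ->. Qed.

Lemma iter_consE n : iteri n (fun i s => i :: s) [::] = rev (iota 0 n).
Proof.
elim: n => // n IHn; rewrite [LHS]/= IHn -rev_rcons -cats1.
by rewrite -(addn1 n) iotaD.
Qed.

Section Game.

(* A Mealy machine with a one-letter lookahead over the letters 0 .. T-1 and
   the states 0 .. nZ-1, iterated on the stream [0 ^ c beta ^ omega]. *)
Variables (T nZ c beta : nat) (bad : pred nat).
Variables (first : nat -> nat) (nxt out : nat -> nat -> nat).

Fixpoint mealy_state (f : nat -> nat) (y : nat) : nat :=
  if y is y'.+1 then nxt (mealy_state f y') (f y) else first (f 0).

(** The lookahead matches the delay between the players: player 2, started one step later, emits its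
    letter [y] while player 1 emits its letter [y.+1]. *)
Definition mealy (f : nat -> nat) (y : nat) : nat :=
  out (mealy_state f y) (f y.+1).

Fixpoint streams (x : nat) : nat -> nat :=
  if x is x'.+1 then mealy (streams x') else fun y => if y < c then 0 else beta.

(* States: 0 = lost; 1 = both players wait; 2 = both players were started at
   the same time; 3 = player 1 has just been started, player 2 will be next;
   4 + z = player 2 was started one step after player 1, the Mealy machine
   being in state z; nZ + 4 = player 1 must play beta forever; nZ + 5 + k =
   player 1 must play the letter 0. The chain of the states nZ + 5 + k is
   traversed downwards from the initial state k = c + 1; its states k = c and
   k = c + 1 are observed as waiting. All of the chain, even its initial state,
   follows one rule: the adversary may leave it for state 1 (e = 0). *)
Definition game_step (s a1 a2 e : nat) : nat :=
  match s with
  | 0 => 0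
  | 1 => match e with 0 => 1 | 1 => 2 | _ => 3 end
  | 2 => if (a1 == a2) && ~~ bad a1 then 2 else 0
  | 3 => 4 + first a1
  | z.+4 => if z < nZ then if a2 == out z a1 then 4 + nxt z a1 else 0
            else if z == nZ then if a1 == beta then s else 0
            else if e == 0 then 1 else if a1 == 0 then s.-1 else 0
  end.

Lemma game_stepZ z a1 a2 e : z < nZ ->
  game_step (4 + z) a1 a2 e = if a2 == out z a1 then 4 + nxt z a1 else 0.
Proof. by move=> lt_z; rewrite /game_step /= lt_z. Qed.

Lemma game_stepB a1 a2 e :
  game_step (nZ + 4) a1 a2 e = if a1 == beta then nZ + 4 else 0.
Proof. by rewrite addnC /game_step /= ltnn eqxx. Qed.

Lemma game_stepC k a1 a2 e : 0 < k -> game_step (nZ + 4 + k) a1 a2 e =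
  if e == 0 then 1 else if a1 == 0 then nZ + 4 + k.-1 else 0.
Proof.
case: k => // k _; have -> : nZ + 4 + k.+1 = (nZ + k.+1).+4 by lia.
rewrite /game_step ifF; last by lia.
by rewrite ifF; [rewrite -pred_Sn; have -> : nZ + 4 + k = (nZ + k.+1).+3 by lia | lia].
Qed.

(** Building the table by intervals of states makes the part outside of the chain a list that does
    not depend on [c]. *)
Definition game_table lo n (l : seq ((nat * seq nat) * nat)) :=
  iteri n (fun i => iteri T (fun a1 => iteri T (fun a2 => iteri 3 (fun e l =>
    ((lo + i, [:: a1; a2; e]), game_step (lo + i) a1 a2 e) :: l)))) l.

Variables (AP : countType) (ok : AP).

(** Long lists are built by [nseq] and [iteri], whose codes are easy to compute. In [cls], the first
    two agents see class 0 when waiting: in state 1, in the two topmost chain states and, for player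
    2, also in state 3. The adversary sees the exact state. *)
Definition game : acgs AP :=
  let B := nZ + 5 in let n := B + c.+2 in
  {| nS := n; init := [:: n.-1]; nA := 3; nac := [:: T; T; 3];
     cls := let run := nseq (B + c - 4) 1 ++ [:: 0; 0] in
            [:: [:: 1, 0, 1, 1 & run]; [:: 1, 0, 1, 0 & run];
                iteri n (fun i s => i :: s) [::]];
     prot := let all := nseq n (iteri T (fun i s => i :: s) [::]) in
             [:: all; all; nseq n (iteri 3 (fun i s => i :: s) [::])];
     dtab := game_table B c.+2 (game_table 0 B [::]);
     lab := [::] :: nseq n.-1 [:: ok];
     pity := [:: 3; 3; 1] |}.

Hypotheses (c0 : 0 < c) (betaT : beta < T).
Hypothesis (firstP : forall a, a < T -> first a < nZ).
Hypothesis (nxtP : forall z a, z < nZ -> a < T -> nxt z a < nZ).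
Hypothesis (outP : forall z a, z < nZ -> a < T -> out z a < T).

Let nS' := nZ + c + 7.
Let nSE : nS game = nS'. Proof. by rewrite /game /nS'; cbn [nS]; lia. Qed.

Definition game_obs (i s : nat) : nat :=
  if (s == 1) || (nZ + c + 5 <= s) || (i == 1) && (s == 3) then 0 else 1.

Lemma mem_game_table x lo n l : x \in game_table lo n l <->
  (exists s a1 a2 e, [/\ lo <= s < lo + n, a1 < T, a2 < T, e < 3 &
      x = ((s, [:: a1; a2; e]), game_step s a1 a2 e)]) \/ x \in l.
Proof.
pose ent s a1 a2 e := ((s, [:: a1; a2; e]), game_step s a1 a2 e).
have := @mem_iteri _ (fun i => exists2 a1, a1 < T & exists2 a2, a2 < T &
  exists2 e, e < 3 & x = ent (lo + i) a1 a2 e) (fun i => iteri T (fun a1 =>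
  iteri T (fun a2 => iteri 3 (fun e l => ent (lo + i) a1 a2 e :: l)))) x.
move=> H; rewrite H => [|i {}l]; last first.
  apply: mem_iteri => a1 {}l; apply: mem_iteri => a2 {}l; exact: mem_iter_cons.
split=> [[[i lt_i [a1 ? [a2 ? [e ? ->]]]]|]|[[s [a1 [a2 [e [? ? ? ? ->]]]]]|]].
- by left; exists (lo + i), a1, a2, e; split=> //; lia.
- by right.
- left; exists (s - lo); first by lia.
  by exists a1 => //; exists a2 => //; exists e => //; rewrite subnKC //; lia.
- by right.
Qed.

Lemma mem_game_dtab x : x \in dtab game <->
  exists s a1 a2 e, [/\ s < nS', a1 < T, a2 < T, e < 3 &
      x = ((s, [:: a1; a2; e]), game_step s a1 a2 e)].
Proof.
rewrite /game; cbn [dtab]; rewrite !mem_game_table /nS'.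
split=> [[|[|//]] [s [a1 [a2 [e [? ? ? ? ->]]]]]|[s [a1 [a2 [e [? ? ? ? ->]]]]]].
- by exists s, a1, a2, e; split=> //; lia.
- by exists s, a1, a2, e; split=> //; lia.
by case: (leqP (nZ + 5) s) => ?; [left|right; left];
  exists s, a1, a2, e; split=> //; lia.
Qed.

Lemma game_step_lt s a1 a2 e : s < nS' -> a1 < T -> a2 < T -> e < 3 ->
  game_step s a1 a2 e < nS'.
Proof.
rewrite /nS'; case: s => [|[|[|[|z]]]] lt_s lt1 lt2 lt3 /=; try by lia.
- by case: e lt3 => [|[|]]; lia.
- by case: ifP; lia.
- by have := firstP lt1; lia.
case: ifP => [lt_z|_]; first by case: ifP => _; have := nxtP lt_z lt1; lia.
case: ifP => _; first by case: ifP; lia.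
by case: ifP => _; last case: ifP; lia.
Qed.

(** [Delta] takes the first entry of [dtab] with the given key, and all such entries agree. *)
Lemma game_DeltaE s a1 a2 e : s < nS' -> a1 < T -> a2 < T -> e < 3 ->
  Delta game s [:: a1; a2; e] = game_step s a1 a2 e.
Proof.
rewrite /nS' => lt_s lt1 lt2 lt3; rewrite /Delta.
set l := filter _ _.
have memP x : x \in l <-> x = ((s, [:: a1; a2; e]), game_step s a1 a2 e).
  rewrite mem_filter; split=> [/andP[/eqP Ex]|->].
    move/mem_game_dtab => [? [? [? [? [_ _ _ _ E]]]]].
    by move: Ex; rewrite E => -[-> -> -> ->].
  by rewrite eqxx; apply/mem_game_dtab; exists s, a1, a2, e.
case: l memP => [|x l] memP.
  by have := (memP _).2 erefl; rewrite in_nil.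
by rewrite ((memP x).1 (mem_head _ _)).
Qed.

Lemma game_P_E i s : s < nS' -> i < 3 ->
  forall a, a \in P_ game i s = (a < nth 0 [:: T; T; 3] i).
Proof.
rewrite -nSE /P_ => lt_s lt_i a.
have memE n : (a \in iteri n (fun j s => j :: s) [::]) = (a < n).
  by rewrite iter_consE mem_rev mem_iota.
case: i lt_i => [|[|[|]]] //= _; rewrite nth_nseq lt_s ?memE //.
by clear memE; case: a => [|[|[|]]].
Qed.

Lemma game_simE i s s' : s < nS' -> s' < nS' -> i < 2 ->
  sim game i s s' = (game_obs i s == game_obs i s').
Proof.
have obsE t j : t < nS' -> j < 2 -> nth 0 (nth [::] (cls game) j) t = game_obs j t.
  rewrite /game_obs /nS' => lt_t lt_j.
  case: j lt_j => [|[|]] // _; case: t lt_t => [|[|[|[|t]]]] lt_t //=;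
    rewrite ?orbT //; (try by rewrite ifF //; lia);
  rewrite nth_cat size_nseq nth_nseq;
  (case: ltnP => ?; first by rewrite ifF //; lia);
  rewrite ifT; (try lia); by case: (t - _) => [|[|k]] //=; rewrite nth_nil.
by move=> ? ? ?; rewrite /sim !obsE.
Qed.

Lemma game_sim2E s s' : s < nS' -> s' < nS' -> sim game 2 s s' -> s = s'.
Proof.
rewrite -nSE /sim /= iter_consE => lt_s lt_s' /eqP/esym/eqP.
rewrite nth_uniq ?size_rev ?size_iota ?rev_uniq ?iota_uniq //.
by move/eqP->.
Qed.

Lemma game_admissible : admissible game.
Proof.
split=> //; last by move=> [|[|[|i]]].
split; first by rewrite /= andbT; lia.
split=> //; split.
  split=> //=; rewrite size_cat size_nseq size_iter_cons /= addn0 eqxx.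
  by rewrite !andbT; lia.
split; first by rewrite /= !size_nseq eqxx.
split.
  move=> i s a lt_i; rewrite nSE => lt_s; rewrite game_P_E //.
split.
  move=> i s s' lt_i; rewrite nSE => lt_s lt_s' _ a.
  by rewrite !game_P_E.
split.
  move=> s a; rewrite nSE => lt_s.
  case: a => [|a1 [|a2 [|e [|]]]] // _ /= H.
  have [/(_ isT) ? /(_ isT) ? /(_ isT) ?] := And3 (H 0) (H 1) (H 2).
  exists (game_step s a1 a2 e).
  by apply/mem_game_dtab; exists s, a1, a2, e.
split.
  apply/allP => x; rewrite nSE => /mem_game_dtab.
  by case=> [s [a1 [a2 [e [? ? ? ? ->]]]]]; apply: game_step_lt.
split; first by rewrite /= size_nseq; lia.
split=> //; split; first by case=> [|[|[|]]].
move=> [|[|[|i]]] // s s' _ _; rewrite nSE; exact: game_sim2E.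
Qed.

(** * Legal plays of the game *)

Definition legal (th : nat -> seq nat -> nat) : Prop :=
  forall i h, i < 3 -> is_hist game h -> th i h \in P_ game i (last 0 h).

Lemma hist_last h : is_hist game h -> last 0 h < nS'.
Proof.
by case: h => [|s h] [] // _ /allP H _; rewrite -nSE; apply: H; exact: mem_last.
Qed.

Lemma hist_rcons h t a : is_hist game h -> joint_ok game (last 0 h) a ->
  Delta game (last 0 h) a = t -> t < nS' -> is_hist game (rcons h t).
Proof.
move=> [h0 lt_h Hh] ja Da lt_t; split; first by case: (h).
  by rewrite all_rcons nSE lt_t -nSE.
move=> j; rewrite size_rcons ltnS => lt_j.
rewrite !nth_rcons lt_j; case: ltnP => [|ge_j]; first exact: Hh.
have Ej : j.+1 = size h by lia.
by rewrite Ej eqxx; exists a; rewrite -nth_last -Ej in ja Da *.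
Qed.

Lemma play_prefix_hist th s j : legal th -> s < nS' ->
  is_hist game (play_prefix game th s j).
Proof.
move=> legal_th lt_s; elim: j => [|j IHj] /=; first by split=> //; rewrite all_seq1 nSE.
set h := play_prefix _ _ _ _ in IHj *.
have Eh : last s h = last 0 h by case: h IHj => // -[].
have lt_l := hist_last IHj.
rewrite Eh; apply: (hist_rcons IHj _ erefl).
  by split=> // -[|[|[|i]]] // _; apply: legal_th.
have legal_i i : i < 3 -> th i h < nth 0 [:: T; T; 3] i.
  by move=> lt_i; rewrite -(game_P_E lt_l lt_i); apply: legal_th.
have := (legal_i 0, legal_i 1, legal_i 2) => /= -[[/(_ isT) ? /(_ isT) ?] /(_ isT) ?].
by rewrite game_DeltaE //; apply: game_step_lt.
Qed.

Lemma play_prefixS th s j h : legal th -> s < nS' ->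
  play_prefix game th s j = h ->
  [/\ is_hist game h, th 0 h < T, th 1 h < T, th 2 h < 3 &
  play_prefix game th s j.+1 =
     rcons h (game_step (last 0 h) (th 0 h) (th 1 h) (th 2 h))].
Proof.
move=> legal_th lt_s Eh; have Hh := play_prefix_hist j legal_th lt_s.
rewrite Eh in Hh; have lt_l := hist_last Hh.
have legal_i i : i < 3 -> th i h < nth 0 [:: T; T; 3] i.
  by move=> lt_i; rewrite -(game_P_E lt_l lt_i); apply: legal_th.
have := (legal_i 0, legal_i 1, legal_i 2) => /= -[[/(_ isT) ? /(_ isT) ?] /(_ isT) ?].
rewrite /= Eh; have -> : last s h = last 0 h by case: (h) Hh => // -[].
by split=> //; rewrite game_DeltaE.
Qed.

Lemma size_play_prefix th s j : size (play_prefix game th s j) = j.+1.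
Proof. by elim: j => //= j; rewrite size_rcons => ->. Qed.

Lemma strategy_legal i th : i < 3 -> is_strategy game i th ->
  forall h, is_hist game h -> th h \in P_ game i (last 0 h).
Proof. by case: i => [|[|[|i]]] // _; rewrite /is_strategy /=; case. Qed.

Lemma strategy_obs i th h h' : i < 2 -> is_strategy game i th ->
  is_hist game h -> is_hist game h' ->
  map (game_obs i) h = map (game_obs i) h' -> th h = th h'.
Proof.
move=> lt_i th_st Hh Hh' E.
have [_ th_eq] : (forall h, is_hist game h -> th h \in P_ game i (last 0 h)) /\
    (forall h h', is_hist game h -> is_hist game h' -> indist game i h h' ->
       th h = th h').
  by case: i lt_i th_st {E} => [|[|]].
apply: th_eq => //; have Es := congr1 size E; rewrite !size_map in Es.
split=> // j lt_j.
have lt_nth g k : is_hist game g -> k < size g -> nth 0 g k < nS'.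
  by case=> _ /allP Hg _ lt_k; rewrite -nSE; apply: Hg; exact: mem_nth.
rewrite game_simE ?lt_nth // -?Es //.
by have := congr1 (nth 0 ^~ j) E; rewrite !(nth_map 0) -?Es // => ->.
Qed.

Lemma strategy2 th : (forall h, is_hist game h -> th h \in P_ game 2 (last 0 h)) ->
  is_strategy game 2 th.
Proof. by []. Qed.

(** * Winning strategies and the iterated streams *)

Let s0 := nZ + c + 6.

Lemma game_stepI a1 a2 e : game_step s0 a1 a2 e =
  if e == 0 then 1 else if a1 == 0 then s0.-1 else 0.
Proof.
have -> : s0 = (nZ + c + 2).+4 by rewrite /s0; lia.
rewrite /game_step ifF; last by lia.
by rewrite ifF //; lia.
Qed.

Lemma game_obsZ i z : z < nZ -> game_obs i (4 + z) = 1.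
Proof.
move=> lt_z; rewrite /game_obs andbF orbF ifF //=.
by apply/negbTE; rewrite -ltnNge; lia.
Qed.

Lemma game_obsE i : [/\ game_obs i s0 = 0, game_obs i 1 = 0, game_obs i 2 = 1,
  game_obs 0 3 = 1 & game_obs 1 3 = 0].
Proof.
split; rewrite /game_obs; [rewrite ifT| |rewrite ifF|rewrite ifF|] => //;
  by rewrite ?orbF ?andbF /s0 /= ?orbT //; lia.
Qed.

Lemma nseq_rcons (X : Type) n (x : X) : nseq n.+1 x = rcons (nseq n x) x.
Proof. by elim: n => //= n ->. Qed.

Lemma last_nseq (X : Type) n (x : X) : last x (nseq n x) = x.
Proof. by elim: n. Qed.

(** Three kinds of plays force the letters of a winning coalition: a joint start makes the two
    streams agree and avoid bad letters, a delayed start ties stream [x.+1] to stream [x], and the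
    chain fixes stream 0. Equal observations carry letters from one play to another. *)
Lemma game_sound :
  sat_coal_G game [:: 0; 1] ok s0 -> forall x y, ~~ bad (streams x y).
Proof.
have I_lt : s0 < nS' by rewrite /s0 /nS'; lia.
case=> thA [strA win].
(* The adversary follows a timetable: it plays [ch j] at time [j], when the history has [j.+1]
   states. *)
pose th (ch : nat -> nat) i := if i \in [:: 0; 1] then thA i
                               else fun h => ch (size h).-1.
have str i : i < 2 -> is_strategy game i (thA i).
  by move=> lt_i; apply: strA; case: i lt_i => [|[|]].
have legal_th ch : (forall j, ch j < 3) -> legal (th ch).
  move=> lt_ch [|[|[|//]]] h _ Hh; rewrite /th.
  - by apply: (strategy_legal (i := 0)) => //; apply: str.
  - by apply: (strategy_legal (i := 1)) => //; apply: str.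
  - by rewrite game_P_E ?hist_last.
have safe ch j : (forall j, ch j < 3) -> last s0 (play_prefix game (th ch) s0 j) != 0.
  move=> lt_ch; have /win/(_ j) : forall i, i < nA game -> i \notin [:: 0; 1] ->
      is_strategy game i (fun h => ch (size h).-1).
    move=> [|[|[|i]]] // _ _; apply: strategy2 => h Hh.
    by rewrite game_P_E ?hist_last.
  rewrite /play -/(th ch); set s := last _ _; by case: s.
have step ch j h : (forall j, ch j < 3) -> play_prefix game (th ch) s0 j = h ->
    [/\ is_hist game h, thA 0 h < T, thA 1 h < T &
        let t := game_step (last 0 h) (thA 0 h) (thA 1 h) (ch j) in
        t != 0 /\ play_prefix game (th ch) s0 j.+1 = rcons h t].
  move=> lt_ch Eh; have [? ? ? _] := play_prefixS (legal_th _ lt_ch) I_lt Eh.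
  have -> : th ch 2 h = ch j by rewrite /th /= -Eh size_play_prefix.
  move=> E; split=> //; split=> //.
  by have := safe ch j.+1 lt_ch; rewrite E last_rcons.
have pre_wait ch x : (forall j, ch j < 3) -> (forall j, j <= x -> ch j = 0) ->
    play_prefix game (th ch) s0 x.+1 = s0 :: nseq x.+1 1.
  move=> lt_ch; elim: x => [|x IHx] ch0.
    have [_ _ _ /= [_ ->]] := step ch 0 [:: s0] lt_ch erefl.
    by rewrite game_stepI ch0.
  have [_ _ _ [_ ->]] := step ch x.+1 _ lt_ch (IHx (fun j Hj => ch0 j (leqW Hj))).
  by rewrite /= last_nseq /= ch0 // -nseq_rcons.
(* Both players were started after [x.+2] waiting states, the initial one included, and are about to
   emit letter number [y], which is [F i x y]. *)
pose hE x y := s0 :: nseq x.+1 1 ++ nseq y.+1 2.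
pose F i x y := thA i (hE x y).
have both x y : [/\ is_hist game (hE x y), F 0 x y < T, F 0 x y = F 1 x y
                  & ~~ bad (F 0 x y)].
  pose ch j := if j <= x then 0 else 1.
  have lt_ch j : ch j < 3 by rewrite /ch; case: ifP.
  have pre : play_prefix game (th ch) s0 (x.+2 + y) = hE x y.
    elim: y => [|y IHy].
      have [|_ _ _ [_]] := step ch x.+1 (s0 :: nseq x.+1 1) lt_ch.
        by apply: pre_wait => // j Hj; rewrite /ch Hj.
      by rewrite addn0 => ->; rewrite /= last_nseq /ch ltnn /hE cats1.
    rewrite addnS; have [_ _ _ []] := step ch _ _ lt_ch IHy.
    rewrite /= last_cat /= last_nseq /=; case: ifP => // _ _ ->.
    by rewrite /hE [nseq y.+2 2]nseq_rcons -rcons_cat.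
  have [? ? ? [+ _]] := step ch _ _ lt_ch pre.
  rewrite {1}/hE /= last_cat /= last_nseq /=.
  by case: ifP => // /andP[/eqP].
pose obs x y := nseq x.+2 0 ++ nseq y.+1 1.
have obsF i x y h : i < 2 -> is_hist game h -> map (game_obs i) h = obs x y ->
    thA i h = F i x y.
  move=> lt_i Hh Eo; have [Hh' _ _ _] := both x y.
  apply: (strategy_obs lt_i (str i lt_i)) => //; rewrite Eo /hE /obs.
  by rewrite map_cons map_cat !map_nseq; have [-> -> -> _ _] := game_obsE i.
have zlt x k : mealy_state (F 0 x) k < nZ.
  have ltF y : F 0 x y < T by case: (both x y).
  by elim: k => [|k IHk] /=; [apply: firstP | apply: nxtP].
have FS x y : F 0 x.+1 y = mealy (F 0 x) y.
  pose ch j := if j <= x then 0 else 2.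
  have lt_ch j : ch j < 3 by rewrite /ch; case: ifP.
  pose zs k := mkseq (fun i => 4 + mealy_state (F 0 x) i) k.
  have obs_zs i k : map (game_obs i) (zs k) = nseq k 1.
    rewrite -[in RHS](size_mkseq (fun i => 4 + mealy_state (F 0 x) i) k).
    rewrite -/(zs k) -(size_map (game_obs i)).
    apply/all_pred1P; rewrite all_map; apply/allP => s /mapP[j _ ->] /=.
    by rewrite game_obsZ.
  (* Player 1 observes [obs x k] in [h2 k], whereas player 2, for whom state 3 looks like waiting,
     observes [obs x.+1 k] in [h2 k.+1]. *)
  pose h2 k := s0 :: nseq x.+1 1 ++ 3 :: zs k.
  have obs0 k : map (game_obs 0) (h2 k) = obs x k.
    rewrite /h2 /obs map_cons map_cat map_cons obs_zs map_nseq.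
    by have [-> -> _ -> _] := game_obsE 0.
  have obs1 k : map (game_obs 1) (h2 k.+1) = obs x.+1 k.
    rewrite /h2 /obs map_cons map_cat map_cons obs_zs map_nseq.
    by have [-> -> _ _ ->] := game_obsE 1; rewrite -cat_rcons -nseq_rcons.
  have stp k : is_hist game (h2 k) -> thA 0 (h2 k) = F 0 x k.
    by move=> Hh; apply: obsF.
  have pre k : play_prefix game (th ch) s0 (x.+2 + k) = h2 k.
    elim: k => [|k IHk].
      have [|_ _ _ [_]] := step ch x.+1 (s0 :: nseq x.+1 1) lt_ch.
        by apply: pre_wait => // j Hj; rewrite /ch Hj.
      by rewrite addn0 => ->; rewrite /= last_nseq /ch ltnn /h2 /= cats1.
    rewrite addnS; have [Hh _ _ [+ ->]] := step ch _ _ lt_ch IHk.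
    rewrite (stp _ Hh); move: (thA 1 (h2 k)) (ch _) => a2 e.
    rewrite /h2 last_cons last_cat last_cons.
    rewrite rcons_cons rcons_cat rcons_cons [zs k.+1]mkseqS -/(zs k) => nz.
    congr (_ :: _ ++ _ :: rcons _ _); case: k {IHk Hh} nz => [|k] //.
    by rewrite [zs k.+1]mkseqS last_rcons game_stepZ //; case: ifP.
  have [Hh ? ? [+ _]] := step ch _ _ lt_ch (pre y.+1).
  rewrite (stp _ Hh) (obsF 1 x.+1 y) // /h2 last_cons last_cat last_cons.
  rewrite [zs y.+1]mkseqS last_rcons game_stepZ //.
  by case: (both x.+1 y) => _ _ -> _; case: ifP => // /eqP.
(* With action 1 throughout, the play descends the chain; the truncated subtraction keeps it in
   state [nZ + 4] afterwards. The first two states look like waiting, as in a start with [x = 0]. *)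
pose h3 j := mkseq (fun i => nZ + 4 + (c + 2 - i)) j.
have F0 y : F 0 0 y = if y < c then 0 else beta.
  have obs3 k : map (game_obs 0) (h3 k.+3) = obs 0 k.
    apply: (@eq_from_nth _ 0) => [|j].
      by rewrite size_map size_mkseq size_cat !size_nseq.
    rewrite size_map size_mkseq => lt_j.
    rewrite (nth_map 0) ?size_mkseq // nth_mkseq // nth_cat !nth_nseq size_nseq.
    rewrite /game_obs; case: ltnP => ?; first by rewrite ifT //; lia.
    by rewrite ifF ?ifT //; lia.
  have lt_ch (j : nat) : 1 < 3 by [].
  have pre k : play_prefix game (th (fun=> 1)) s0 k = h3 k.+1.
    elim: k => [|k IHk]; first by congr [:: _]; rewrite /s0; lia.
    have [_ _ _ []] := step _ _ _ lt_ch IHk.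
    move: (thA 0 _) (thA 1 _) => a1 a2 + ->.
    rewrite [h3 k.+2]mkseqS -/(h3 k.+1) => nz; congr rcons; move: nz.
    rewrite [h3 k.+1]mkseqS last_rcons.
    have [lt_k|ge_k] := ltnP k c.+2.
      rewrite game_stepC; last by lia.
      by case: ifP => // _ _; lia.
    rewrite (_ : c + 2 - k = 0); last by lia.
    rewrite addn0 game_stepB (_ : c + 2 - k.+1 = 0); last by lia.
    by case: ifP; rewrite ?addn0.
  have [Hh ? ? [+ _]] := step _ _ _ lt_ch (pre y.+2).
  rewrite (obsF 0 0 y) // [h3 y.+3]mkseqS last_rcons.
  have [lt_y|ge_y] := ltnP y c.
    by rewrite game_stepC; [case: ifP => // /eqP | lia].
  rewrite (_ : c + 2 - y.+2 = 0); last by lia.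
  by rewrite addn0 game_stepB; case: ifP => // /eqP.
have FE x y : F 0 x y = streams x y.
  elim: x y => [|x IHx] y; first exact: F0.
  rewrite FS /= /mealy IHx; congr out.
  by elim: y => [|y IHy] /=; rewrite ?IHy IHx.
by move=> x y; rewrite -FE; case: (both x y).
Qed.

(* The honest players recover (x, y) from the number of waiting observations
   and the length of the current run of other observations. *)
Definition waits (w : seq nat) := count_mem 0 w.
Definition final_run (w : seq nat) := foldl (fun t o => if o == 0 then 0 else t.+1) 0 w.

Lemma waits_rcons w o : waits (rcons w o) = waits w + (o == 0).
Proof. by rewrite /waits -cats1 count_cat /= addn0. Qed.

Lemma final_run_rcons w o :
  final_run (rcons w o) = if o == 0 then 0 else (final_run w).+1.
Proof. by rewrite /final_run foldl_rcons. Qed.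

Lemma streams_ltT x y : streams x y < T.
Proof.
elim: x y => [|x IHx] y /=.
  by case: ifP => // _; apply: leq_ltn_trans betaT.
apply: outP (IHx _); elim: y => [|y IHy] /=; first exact: firstP.
exact: nxtP.
Qed.

(** The arguments are the state, the waits counted by players 1 and 2, and the lengths of their
    current runs. With [x] waits and a run of length [y], a player emits letter [y - 1] of stream
    [x - 2]. *)
Inductive game_inv : nat -> nat -> nat -> nat -> nat -> Prop :=
| InvInit : game_inv s0 1 1 0 0
| InvChain k y : k + y = c -> game_inv (nZ + 5 + k) 2 2 y y
| InvBeta y : c < y -> game_inv (nZ + 4) 2 2 y y
| InvWait x : 1 < x -> game_inv 1 x x 0 0
| InvBoth x y : 1 < x -> game_inv 2 x x y.+1 y.+1
| InvFirst x : 1 < x -> game_inv 3 x x.+1 1 0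
| InvStep x y : 1 < x ->
    game_inv (4 + mealy_state (streams (x - 2)) y) x x.+1 y.+2 y.+1.

Lemma game_inv_step s x0 x1 y0 y1 e :
  (forall x y, ~~ bad (streams x y)) -> game_inv s x0 x1 y0 y1 ->
  let s' := game_step s (streams (x0 - 2) (y0 - 1)) (streams (x1 - 2) (y1 - 1)) e in
  game_inv s' (x0 + (game_obs 0 s' == 0)) (x1 + (game_obs 1 s' == 0))
    (if game_obs 0 s' == 0 then 0 else y0.+1)
    (if game_obs 1 s' == 0 then 0 else y1.+1).
Proof.
have zlt x k : mealy_state (streams x) k < nZ.
  elim: k => [|k IHk]; [exact/firstP/streams_ltT | exact/nxtP/streams_ltT].
have obs_wait i k : game_obs i (nZ + 5 + c + k) = 0.
  by rewrite /game_obs ifT //; apply/orP; left; apply/orP; right; lia.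
have obs_chain i k : k <= c -> game_obs i (nZ + 4 + k) = 1.
  by move=> ?; rewrite /game_obs ifF //; case: (i == 1) => //=; lia.
move=> good inv; cbv zeta.
case: inv => [|k y Ek|y lt_y|x lt_x|x y lt_x|x lt_x|x y lt_x].
- rewrite game_stepI; case: eqP => _; first exact: InvWait.
  (* The chain demands the letter 0 already in the initial state, where the truncated subtractions
     yield [streams 0 0]; this is 0 because [c] is positive. *)
  rewrite /= c0 /=; have -> : s0.-1 = nZ + 5 + c + 0 by rewrite /s0; lia.
  by rewrite !obs_wait addn0; apply: InvChain; rewrite addn0.
- rewrite (_ : nZ + 5 + k = nZ + 4 + k.+1); last by lia.
  rewrite game_stepC //=; case: eqP => _; first exact: InvWait.
  rewrite ?subnn /= (_ : y - 1 < c) /=; last by lia.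
  rewrite !obs_chain /= ?addn0; try by lia.
  case: k Ek => [|k] Ek; first by rewrite addn0; apply: InvBeta; lia.
  rewrite (_ : nZ + 4 + k.+1 = nZ + 5 + k); last by lia.
  by apply: InvChain; lia.
- rewrite game_stepB ?subnn /= (_ : (y - 1 < c) = false) /=; last by lia.
  rewrite eqxx; have := (obs_chain ^~ 0) => /(_ _ (leq0n _)); rewrite addn0 => oE.
  by rewrite !oE /=; apply: InvBeta; lia.
- case: e => [|[|e]] /=.
  + by rewrite !addn1; apply: InvWait; lia.
  + have [_ _ -> _ _] := game_obsE 0; have [_ _ -> _ _] := game_obsE 1.
    by rewrite /= ?addn0; apply: InvBoth.
  + have [_ _ _ -> ->] := game_obsE 0.
    by rewrite /= ?addn0 ?addn1; apply: InvFirst.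
- rewrite /= eqxx good /=.
  have [_ _ -> _ _] := game_obsE 0; have [_ _ -> _ _] := game_obsE 1.
  by rewrite /= ?addn0; apply: InvBoth.
- rewrite (_ : game_step 3 _ _ _ = 4 + mealy_state (streams (x - 2)) 0) //.
  by rewrite !game_obsZ ?addn0; try exact: (zlt _ 0); apply: (@InvStep x 0).
- rewrite game_stepZ ?zlt // subSn // subn1 /= subn1 /= eqxx.
  rewrite -/(mealy_state _ y.+1) !game_obsZ ?zlt //= ?addn0.
  exact: (@InvStep x y.+1).
Qed.

Lemma game_complete :
  (forall x y, ~~ bad (streams x y)) -> sat_coal_G game [:: 0; 1] ok s0.
Proof.
have I_lt : s0 < nS' by rewrite /s0 /nS'; lia.
move=> good; pose thA i h := let w := map (game_obs i) h in
  streams (waits w - 2) (final_run w - 1).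
have strA i : i < 2 -> is_strategy game i (thA i).
  move=> lt_i; have str : (forall h, is_hist game h -> thA i h \in P_ game i (last 0 h)) /\
    (forall h h', is_hist game h -> is_hist game h' -> indist game i h h' ->
       thA i h = thA i h').
    split=> [h Hh|h h' Hh Hh' [Es Ho]].
      rewrite game_P_E ?hist_last //; last by apply: leq_trans lt_i _.
      by case: i lt_i => [|[|]] // _; apply: streams_ltT.
    rewrite /thA (_ : map (game_obs i) h = map (game_obs i) h') //.
    apply: (@eq_from_nth _ 0) => [|j]; rewrite !size_map // => lt_j.
    have lt_nth g k : is_hist game g -> k < size g -> nth 0 g k < nS'.
      by case=> _ /allP Hg _ lt_k; rewrite -nSE; apply: Hg; exact: mem_nth.
    have := Ho j lt_j; rewrite game_simE ?lt_nth -?Es // => /eqP.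
    by rewrite !(nth_map 0) -?Es.
  by case: i lt_i str => [|[|]].
exists thA; split=> [i _ Ai|thO strO j].
  by apply: strA; move: Ai; rewrite !inE => /orP[] /eqP->.
set th := fun i => _.
have legal_th : legal th.
  move=> i h lt_i Hh; apply: (strategy_legal lt_i) => //.
  rewrite /th; case: ifP => [|/negbT] Ai; last exact: strO.
  by apply: strA; move: Ai; rewrite !inE => /orP[] /eqP->.
have inv k : let h := play_prefix game th s0 k in
    game_inv (last 0 h) (waits (map (game_obs 0) h)) (waits (map (game_obs 1) h))
      (final_run (map (game_obs 0) h)) (final_run (map (game_obs 1) h)).
  elim: k => [|k IHk] h.
    have [oI _ _ _ _] := game_obsE 0; have [oI1 _ _ _ _] := game_obsE 1.
    by rewrite /h /= oI oI1 /waits /=; apply: InvInit.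
  have [_ _ _ _ Eh] := play_prefixS legal_th I_lt (erefl (play_prefix game th s0 k)).
  rewrite /h {h} Eh !map_rcons !waits_rcons !final_run_rcons last_rcons.
  exact: game_inv_step.
have := inv j; rewrite /play /=.
have /hist_last := play_prefix_hist j legal_th I_lt.
case: (play_prefix game th s0 j) (size_play_prefix th s0 j) => // s h _ /=.
move: (last s h) => t lt_t Hinv.
have : 0 < t by case: Hinv => *; rewrite /s0; lia.
case: t lt_t {Hinv} => // t lt_t _; rewrite /lambda /= nth_nseq ifT ?inE ?eqxx //.
by rewrite /nS' in lt_t; lia.
Qed.

Lemma game_correct :
  yes_instance ok game <-> forall x y, ~~ bad (streams x y).
Proof.
have initE : init game = [:: s0] by congr [:: _]; rewrite /s0; lia.
split=> [yes|good s]; first by apply: game_sound; apply: yes; rewrite initE mem_head.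
by rewrite initE inE => /eqP->; apply: game_complete.
Qed.

End Game.

(** * Counter machines as Mealy machines *)

Section Numbering.
Variables (X : finType) (x0 : X).

(** [x0] is put in front to get the number 0: the chain asks for the letter 0, which has to stand
    for the first letter of the initial stream. *)
Definition numbering : seq X := x0 :: [seq x <- enum X | x != x0].
Definition enc (x : X) : nat := index x numbering.
Definition dec (n : nat) : X := nth x0 numbering n.

Lemma mem_numbering x : x \in numbering.
Proof. by rewrite inE mem_filter mem_enum andbT orbN. Qed.

Lemma enc_lt x : enc x < size numbering.
Proof. by rewrite index_mem mem_numbering. Qed.

Lemma encK : cancel enc dec.
Proof. by move=> x; rewrite /dec nth_index ?mem_numbering. Qed.

Lemma enc0 : enc x0 = 0.
Proof. by rewrite /enc /= eqxx. Qed.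

End Numbering.

Section MachineStreams.
Variables (D : cm_prog) (R : nat).
Hypothesis D_regs : all (fun i => match i with INC r | DEC r _ => r <= R end) D.

Let N := size D.

(* Letters of configuration streams: the program counter at the head, and the
   vector of the bits [y < reg r] at position y + 1. *)
Definition letter : finType := ('I_N.+1 + {ffun 'I_R.+1 -> bool})%type.

(** All halting program counters are identified with [N], which gives the only bad letter. *)
Definition pc_letter (pc : nat) : letter := inl (inord (minn pc N)).
Definition reg_letter (b : nat -> bool) : letter := inr [ffun r : 'I_R.+1 => b r].
Definition bit (l : letter) (r : nat) : bool :=
  if l is inr f then f (inord r) else false.

Arguments reg_letter : simpl never.
Arguments bit : simpl never.
Arguments pc_letter : simpl never.

Definition config_stream (C : cm_config) (y : nat) : letter :=
  if y is y'.+1 then reg_letter (fun r => y' < C.2 r) else pc_letter C.1.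

(* The head letter and the last two of the subsequent letters. *)
Definition mstate : finType := (letter * option letter * option letter)%type.

Definition m_first (a : letter) : mstate := (a, None, None).
Definition m_next (z : mstate) (a : letter) : mstate := (z.1.1, z.2, Some a).
(* A stream whose head is not a program counter is the initial stream, which
   is mapped to the initial configuration. *)
Definition m_out (z : mstate) (a : letter) : letter :=
  let: (hd, prev, cur) := z in
  if cur is Some u then reg_letter (fun r =>
    if hd is inl q then
      if q < N then
        match nth (INC 0) D q with
        | INC r0 => if r == r0 then (if prev is Some w then bit w r else true)
                    else bit u r
        | DEC r0 _ => if r == r0 then bit a r else bit u r
        end
      else bit u r
    else bit u r)
  else
    if hd is inl q then
      if q < N then
        match nth (INC 0) D q with
        | INC _ => pc_letter q.+1
        | DEC r0 j => pc_letter (if bit a r0 then q.+1 else j)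
        end
      else pc_letter q
    else pc_letter 0.

Definition m_state (f : nat -> letter) (y : nat) : mstate :=
  (f 0, if y is y'.+2 then Some (f y'.+1) else None,
        if y is _.+1 then Some (f y) else None).

Lemma bit_reg_letter b r : r <= R -> bit (reg_letter b) r = b r.
Proof. by move=> le_r; rewrite /bit /= ffunE inordK. Qed.

Lemma eq_reg_letter b b' : (forall r, r <= R -> b r = b' r) ->
  reg_letter b = reg_letter b'.
Proof. by move=> E; congr inr; apply/ffunP => r; rewrite !ffunE E // -ltnS. Qed.

Lemma val_pc_letter pc : (inord (minn pc N) : 'I_N.+1) = minn pc N :> nat.
Proof. by rewrite inordK // ltnS geq_minr. Qed.

Lemma instr_reg pc : pc < N ->
  match nth (INC 0) D pc with INC r | DEC r _ => r <= R end.
Proof. by move=> lt_pc; have /all_nthP := D_regs; apply. Qed.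

(** In unary, an increment shifts a track to the right behind a new true bit, and a decrement shifts
    it to the left. Hence the output uses the previous letter and the lookahead, which also decides
    the zero test at the head. *)
Lemma config_stream_step C y :
  m_out (m_state (config_stream C) y) (config_stream C y.+1) =
  config_stream (cm_step D C) y.
Proof.
case: C => pc reg.
have pcE : (inord (minn pc N) : 'I_N.+1) = minn pc N :> nat := val_pc_letter pc.
rewrite /cm_step -/N; case: (ltnP pc N) => [lt_pc|ge_pc]; last first.
  have E : (inord (minn pc N) : 'I_N.+1) = N :> nat by rewrite pcE; apply/minn_idPr.
  rewrite /m_out /m_state; case: y => [|y] /=; rewrite E ltnn.
    by congr inl; apply: val_inj; rewrite /= val_pc_letter minnn E.
  by apply: eq_reg_letter => r le_r; rewrite bit_reg_letter.
have E : (inord (minn pc N) : 'I_N.+1) = pc :> nat.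
  by rewrite pcE; apply/minn_idPl/ltnW.
have := instr_reg lt_pc; rewrite /m_out /m_state.
case: y => [|y] /=; rewrite E lt_pc; case: (nth _ _ _) => [r0|r0 j] le_r0 //.
- by rewrite bit_reg_letter // lt0n;
    case: eqP.
- apply: eq_reg_letter => r le_r; rewrite /= /cm_upd.
  case: eqP => [->|_]; last by rewrite bit_reg_letter.
  by case: y => [|y] //; rewrite bit_reg_letter.
- apply: eq_reg_letter => r le_r; rewrite !bit_reg_letter //.
  case: (reg r0 =P 0) => [r00|nz] /=; case: (r =P r0) => [->|/eqP ne_r] //.
    by rewrite r00.
  - by rewrite updE; lia.
  - by rewrite updN.
Qed.

Section Coding.
Variable v : nat.

Definition start : cm_config := (0, fun r => if r == 1 then v else 0).

(** Only register 1 has its bit set. After the head, [v] copies of this letter give register 1 the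
    value [v]; with the head this makes [v.+1] copies. *)
Let alpha := reg_letter (eq_op^~ 1).
Let eL := enc alpha.
Let dL := dec alpha.
Let eZ := enc (m_first alpha).
Let dZ := dec (m_first alpha).

Definition letters_nb := size (numbering alpha).
Definition mstates_nb := size (numbering (m_first alpha)).
Definition beta_code := eL (reg_letter xpred0).
Definition bad_code (a : nat) : bool := if dL a is inl q then q == N :> nat else false.
Definition first_code (a : nat) : nat := eZ (m_first (dL a)).
Definition next_code (z a : nat) : nat := eZ (m_next (dZ z) (dL a)).
Definition out_code (z a : nat) : nat := eL (m_out (dZ z) (dL a)).

Lemma mealyE (f : nat -> nat) (g : nat -> letter) : f =1 eL \o g ->
  forall y, mealy first_code next_code out_code f y = eL (m_out (m_state g y) (g y.+1)).
Proof.
move=> E y; rewrite /mealy E /= /out_code.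
have -> : mealy_state first_code next_code f y = eZ (m_state g y).
  elim: y => [|y /= ->]; rewrite /= E /=.
    by rewrite /first_code /dL encK.
  by rewrite /next_code /dL /dZ !encK; case: y.
by rewrite /dL /dZ !encK.
Qed.

Lemma streamsE x y : streams v.+1 beta_code first_code next_code out_code x.+1 y =
  eL (config_stream (iter x (cm_step D) start) y).
Proof.
elim: x y => [|x IHx] y; last first.
  by rewrite [LHS](mealyE IHx) config_stream_step.
pose g y := if y < v.+1 then alpha else reg_letter xpred0.
rewrite [LHS](@mealyE _ g) => [|{}y /=]; last first.
  by rewrite /g; case: ifP => // _; rewrite /eL enc0.
congr eL; rewrite /m_out /m_state; case: y => [|y] //=.
apply: eq_reg_letter => r le_r; rewrite /g ltnS.
by case: ltnP => ?; rewrite bit_reg_letter //; case: eqP => ? //; lia.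
Qed.

Lemma streams_bad :
  (forall x y, ~~ bad_code (streams v.+1 beta_code first_code next_code out_code x y)) <->
  (forall k, ~~ cm_halted D (iter k (cm_step D) start)).
Proof.
split=> H x.
  have := H x.+1 0; rewrite streamsE /bad_code /dL encK /=.
  rewrite /pc_letter val_pc_letter /cm_halted -/N.
  by apply: contra => /minn_idPr/eqP.
case: x => [|x] y; last first.
  rewrite streamsE /bad_code /dL encK /=; case: y => //=.
  rewrite /pc_letter val_pc_letter; apply: contra (H x) => /eqP.
  by rewrite /cm_halted -/N => /minn_idPr.
rewrite /= (_ : (if _ then _ else _) = eL (if y < v.+1 then alpha else reg_letter xpred0)).
  by rewrite /bad_code /dL encK; case: ifP.
by case: ifP => // _; rewrite /eL enc0.
Qed.

Definition machine_game (AP : countType) (ok : AP) : acgs AP :=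
  game letters_nb mstates_nb v.+1 beta_code bad_code first_code next_code out_code ok.

Lemma machine_game_admissible (AP : countType) (ok : AP) : admissible (machine_game ok).
Proof.
by apply: game_admissible => //; move=> *; exact: enc_lt.
Qed.

Lemma machine_game_correct (AP : countType) (ok : AP) : yes_instance ok (machine_game ok) <->
  (forall k, ~~ cm_halted D (iter k (cm_step D) start)).
Proof.
by rewrite -streams_bad; apply: game_correct => // *; exact: enc_lt.
Qed.

End Coding.

End MachineStreams.

(** * The code of a game *)

(** The counterpart of [game] on codes. The table outside of the chain enters only through its code
    [base]; the rule of the chain is the same for all Mealy machines and is written out. *)
Definition game_code (T nZ base okc c : nat) : nat :=
  let B := nZ + 5 in let n := B + c.+2 in
  let run := nseqc (B + c - 4) 1 (consc 0 (consc 0 0)) in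
  let all := nseqc n (iotac T) 0 in
  pairc (pairc (pairc (pairc (pairc (pairc (pairc (pairc
    n (consc n.-1 0)) 3) (consc T (consc T (consc 3 0))))
    (consc (consc 1 (consc 0 (consc 1 (consc 1 run))))
    (consc (consc 1 (consc 0 (consc 1 (consc 0 run)))) (consc (iotac n) 0))))
    (consc all (consc all (consc (nseqc n (iotac 3) 0) 0))))
    (iteri c.+2 (fun i => iteri T (fun a1 => iteri T (fun a2 => iteri 3 (fun e =>
       consc (pairc (pairc (B + i) (consc a1 (consc a2 (consc e 0))))
         (if e == 0 then 1 else if a1 == 0 then (B + i).-1 else 0))))))
     base))
    (consc 0 (nseqc n.-1 okc 0)))
    (consc 3 (consc 3 (consc 1 0))).

Ltac comp := repeat first
  [ comp_weaken | apply: comp_const | apply: comp_pairc | apply: comp_consc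
  | apply: comp_nseqc | apply: comp_iotac | apply: comp_pred
  | apply: comp_add | apply: comp_sub | apply: comp_if0 | apply: comp_succ
  | apply: comp_iter => [||? ? ? ? ? ?] ].

Lemma comp_game_code d fT fZ fb okc fc : computable d fT -> computable d fZ ->
  computable d fb -> computable d fc ->
  computable d (fun rho => game_code (fT rho) (fZ rho) (fb rho) okc (fc rho)).
Proof.
move=> cT cZ cb cc; rewrite /game_code; cbv zeta.
comp.
Qed.

Lemma pickle_pair (X Y : countType) (x : X) (y : Y) :
  pickle (x, y) = pairc (pickle x) (pickle y).
Proof. by []. Qed.

Lemma pickle_cons (X : countType) (x : X) s :
  pickle (x :: s) = consc (pickle x) (pickle s).
Proof. by []. Qed.

Lemma pickle_acgs (AP : countType) (M : acgs AP) :
  pickle M = pickle (acgs_tuple M).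
Proof. by []. Qed.

Lemma pickle_iteri (X : countType) (F : nat -> seq X -> seq X)
    (G : nat -> nat -> nat) n s :
  (forall i l, pickle (F i l) = G i (pickle l)) ->
  pickle (iteri n F s) = iteri n G (pickle s).
Proof. by move=> E; elim: n => //= n <-. Qed.

Lemma pickle_nseq_cat (X : countType) n (x : X) s :
  pickle (nseq n x ++ s) = nseqc n (pickle x) (pickle s).
Proof. by elim: n => //= n IHn; rewrite pickle_cons IHn. Qed.

Lemma pickle_nseq (X : countType) n (x : X) :
  pickle (nseq n x) = nseqc n (pickle x) 0.
Proof. by rewrite -[nseq n x]cats0 pickle_nseq_cat. Qed.

Lemma pickle_iota n : pickle (iteri n (fun i s => i :: s) [::]) = iotac n.
Proof. exact: pickle_iteri. Qed.

Lemma pickle_game T nZ c beta bad first nxt out (AP : countType) (ok : AP) :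
  pickle (game T nZ c beta bad first nxt out ok) =
  game_code T nZ
    (pickle (game_table T nZ beta bad first nxt out 0 (nZ + 5) [::]))
    (pickle [:: ok]) c.
Proof.
rewrite pickle_acgs /acgs_tuple /game; cbn [nS init nA nac cls prot dtab lab pity].
rewrite /game_code !pickle_pair !pickle_cons pickle_nseq_cat !pickle_nseq.
rewrite !pickle_iota.
congr (pairc (pairc (pairc _ _) _) _).
apply: pickle_iteri => i l; apply: pickle_iteri => a1 {}l.
apply: pickle_iteri => a2 {}l; apply: pickle_iteri => e {}l.
rewrite pickle_cons; congr consc; rewrite !pickle_pair; congr pairc.
have -> : nZ + 5 + i = nZ + 4 + i.+1 by lia.
by rewrite game_stepC // (addnS (nZ + 4) i).
Qed.

(** * The diagonal machine *)

Lemma regs_bound (D : cm_prog) :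
  exists R, all (fun i => match i with INC r | DEC r _ => r <= R end) D.
Proof.
elim: D => [|i D [R HR]]; first by exists 0.
exists (maxn R (match i with INC r | DEC r _ => r end)).
rewrite /= (sub_all _ HR) ?andbT; first by case: (i) => *; exact: leq_maxr.
by case=> [r|r _] le_r; rewrite leq_max le_r.
Qed.

Section Relocation.
Variables (P : cm_prog) (o v : nat).

(** Registers move up by two, which protects register 0 and the input in register 1. Jumps beyond
    [P] are cut to its end, so that halting means reaching the code behind it. *)
Definition reloc (i : cm_instr) : cm_instr :=
  match i with INC r => INC r.+2 | DEC r j => DEC r.+2 (o + minn j (size P)) end.

Definition reloc_config (C : cm_config) : cm_config :=
  (o + minn C.1 (size P),
   fun r => match r with 0 => 0 | 1 => v | r'.+2 => C.2 r' end).

Lemma reloc_reach l r n C : size l = o ->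
  reach (l ++ map reloc P ++ r) (reloc_config C)
        (reloc_config (iter n (cm_step P) C)).
Proof.
move=> szl; elim: n C => [|n IHn] C; first exact: reach_refl.
rewrite iterSr; case: (ltnP C.1 (size P)) => [lt_pc|ge_pc]; last first.
  have -> : cm_step P C = C by case: C ge_pc => pc reg; rewrite /cm_step leqNgt => /negbTE->.
  exact: IHn.
apply: reach_step; apply: reach_trans (IHn _); case: C lt_pc => pc reg /= lt_pc.
have -> : reloc_config (cm_step P (pc, reg)) =
    cm_step (l ++ map reloc P ++ r) (reloc_config (pc, reg)).
  rewrite {2}/reloc_config /cm_step lt_pc /= (minn_idPl (ltnW lt_pc)).
  rewrite !size_cat szl ltn_add2l size_map ltn_addr //.
  rewrite nth_cat szl ltnNge leq_addr addKn nth_cat size_map lt_pc.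
  rewrite (nth_map (INC 0)) //.
  case: (nth _ _ _) => [q|q j] /=; last case: ifP => _; rewrite /reloc_config /=;
    rewrite ?(minn_idPl lt_pc) ?addnS //; congr pair;
    by apply: functional_extensionality => -[|[|x]].
exact: reach_refl.
Qed.

End Relocation.

Lemma iter_step_fix (P : cm_prog) C k n : cm_step P (iter k (cm_step P) C) =
  iter k (cm_step P) C -> k <= n -> iter n (cm_step P) C = iter k (cm_step P) C.
Proof.
move=> fixC /subnK<-; elim: (n - k) => // m IHm.
by rewrite addSn iterS IHm.
Qed.

Lemma halted_fix (P : cm_prog) C : cm_halted P C -> cm_step P C = C.
Proof. by case: C => pc reg; rewrite /cm_halted /cm_step leqNgt /= => /negbTE->. Qed.

Theorem theorem1 (AP : finType) (ok : AP) :
  ~ decidable_on (@admissible AP) (@yes_instance AP ok).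
Proof.
case=> P decP; pose okc := pickle [:: ok].
(* [v] is read as the number of letters, the number of Mealy states and the code of the table
   outside of the chain. *)
pose gc v := game_code (fstc v) (fstc (sndc v)) (sndc (sndc v)) okc v.+1.
(* The target, register 2, is the input register 0 of the relocated [P]. *)
have [_ /(_ 2 isT isT) [fr Hfr]] : computable 2 (fun rho => gc (rho 1)).
  have c1 : computable 2 (fun rho => rho 1) by apply: comp_var.
  have c2 := comp_sndc c1.
  by apply: comp_game_code; [apply: comp_fstc | apply: comp_fstc |
    apply: comp_sndc | apply: comp_succ].
pose o := size (fr 0); pose e := o + size P.
(* The last instruction tests the answer of [P]: on 0 it jumps to itself forever, on 1 control runs
   off the end and [D] halts. *)
pose D := fr 0 ++ map (reloc P o) P ++ [:: DEC 2 e].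
have [R D_regs] := regs_bound D.
pose T := letters_nb D R; pose nZ := mstates_nb D R.
pose base := pickle (game_table T nZ (beta_code D R) (@bad_code D R) (@first_code D R)
  (@next_code D R) (@out_code D R) 0 (nZ + 5) [::]).
(* There is no circularity: [T], [nZ] and [base] depend on [D] and [R] but not on [v]. *)
pose v := consc T (consc nZ base).
pose M := machine_game D R v ok.
have pkM : pickle M = gc v.
  by rewrite /gc /v !(fstcE, sndcE); apply: pickle_game.
have szD : size D = e.+1 by rewrite !size_cat size_map /= addnA addn1.
have [yesP noP] := decP M (machine_game_admissible D R v ok).
have runD m : cm_computes P (pickle M) m -> exists rho : regs,
    rho 2 = m /\ reach D (start v) (e, rho).
  case=> k /= [halt <-]; set C := iter _ _ _ in halt *.
  exists (reloc_config P o v C).2; split=> //.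
  have -> : (e, (reloc_config P o v C).2) = reloc_config P o v C.
    by rewrite /e -(minn_idPr halt).
  apply: reach_trans; last first.
    exact: (@reloc_reach P o v (fr 0) [:: DEC 2 e] k (cm_init (pickle M)) erefl).
  have := Hfr (start v).2 erefl _ [::]; move=> /(_ _ (map (reloc P o) P ++ [:: DEC 2 e])).
  rewrite /= add0n -/o => H.
  rewrite (_ : reloc_config _ _ _ _ = (o, cm_upd (start v).2 2 (gc v))).
    rewrite -[start v]/(0, (start v).2); apply: H => i; case: i => [|[|]] //.
  rewrite /reloc_config /= min0n addn0 pkM; congr pair.
  by apply: functional_extensionality => -[|[|[|]]].
have step_e rho : cm_step D (e, rho) =
    if rho 2 == 0 then (e, rho) else (e.+1, cm_upd rho 2 (rho 2).-1).
  have eE : e = size (fr 0 ++ map (reloc P o) P) by rewrite size_cat size_map.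
  by rewrite /D catA [X in cm_step _ (X, _)]eE cm_step_instr -eE.
have nyes : ~ yes_instance ok M.
  move=> yes; have [rho [r2 [k Ek]]] := runD 1 (yesP yes).
  have /(_ k.+1)/negP := (machine_game_correct D_regs v ok).1 yes; apply.
  by rewrite iterS Ek step_e r2 /cm_halted szD /=.
(* Now [P] answers 0, so [D] is trapped at address [e] and never halts; this makes [M] a
   yes-instance after all. *)
apply: (nyes); apply/(machine_game_correct D_regs v ok) => n.
have [rho [r2 [k Ek]]] := runD 0 (noP nyes).
have fix_k : cm_step D (iter k (cm_step D) (start v)) = iter k (cm_step D) (start v).
  by rewrite Ek step_e r2.
have nhalt_k : ~~ cm_halted D (iter k (cm_step D) (start v)).
  by rewrite Ek /cm_halted szD /= ltnn.
have [le_kn|/ltnW le_nk] := leqP k n; first by rewrite (iter_step_fix fix_k).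
(* Halted configurations are fixed as well, so halting before step [k] would persist at step [k]. *)
apply: contra nhalt_k => halt_n.
by rewrite (iter_step_fix (halted_fix halt_n) le_nk).
Qed.
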